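(* Let $(A,\ast,\circ)$ be a pre-Poisson algebra and let $r\in A\otimes A$ be a symmetric solution of the pre-Poisson Yang-Baxter equation in $(A,\ast,\circ)$. Define linear maps $\Delta,\delta:A\to A\otimes A$ by $$\Delta(x)=(I\otimes L_\star(x)-L_\ast(x)\otimes I)r,\qquad \delta(x)=(I\otimes\mathrm{ad}(x)+L_\circ(x)\otimes I)r,\qquad x\in A.$$ Then $(A,\ast,\circ,\Delta,\delta)$ is a coboundary pre-Poisson bialgebra.
   Context: All vector spaces and algebras are finite-dimensional over a field $k$. Algebras. A Zinbiel algebra is a vector space with a bilinear map $\ast$ such that $x\ast(y\ast z)=(y\ast x)\ast z+(x\ast y)\ast z$. A pre-Lie algebra: $x\circ(y\circ z)-(x\circ y)\circ z=y\circ(x\circ z)-(y\circ x)\circ z$. A pre-Poisson algebra is $(A,\ast,\circ)$ with $(A,\ast)$ Zinbiel, $(A,\circ)$ pre-Lie, $(x\circ y-y\circ x)\ast z=x\circ(y\ast z)-y\ast(x\circ z)$ and $(x\ast y+y\ast x)\circ z=x\ast(y\circ z)+y\ast(x\circ z)$. Put $x\star y=x\ast y+y\ast x$ and $[x,y]=x\circ y-y\circ x$. Notation. $L_\ast(x)y=R_\ast(y)x=x\ast y$, similarly $L_\circ,R_\circ$; $L_\star=L_\ast+R_\ast$; $\mathrm{ad}(x)=L_\circ(x)-R_\circ(x)$; $\tau(x\otimes y)=y\otimes x$; $I$ is the identity map. $r$ symmetric means $\tau(r)=r$. Pre-Poisson Yang-Baxter equation (PPYBE): for $r=\sum_i a_i\otimes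 b_i$, both $D(r)=0$ and $S(r)=0$, where $D(r)=\sum_{i,j}\big(a_j\otimes a_i\ast b_j\otimes b_i+a_j\otimes a_i\otimes b_i\ast b_j-a_i\star a_j\otimes b_i\otimes b_j\big)$, $S(r)=\sum_{i,j}\big(-a_i\circ a_j\otimes b_i\otimes b_j+a_i\otimes b_i\circ a_j\otimes b_j+a_i\otimes a_j\otimes[b_i,b_j]\big)$. Coalgebras. Zinbiel coalgebra $(A,\Delta)$: $(\Delta\otimes I)\Delta+(\tau\otimes I)(\Delta\otimes I)\Delta=(I\otimes\Delta)\Delta$. Pre-Lie coalgebra $(A,\delta)$: $(\delta\otimes I)\delta-(I\otimes\delta)\delta=(\tau\otimes I)\big((\delta\otimes I)\delta-(I\otimes\delta)\delta\big)$. Pre-Poisson coalgebra $(A,\Delta,\delta)$: both of these together with $((\delta-\tau\delta)\otimes I)\Delta=(I\otimes\Delta)\delta-(\tau\otimes I)(I\otimes\delta)\Delta$ and $((\Delta+\tau\Delta)\otimes I)\delta=(I\otimes\delta)\Delta+(\tau\otimes I)(I\otimes\delta)\Delta$. Zinbiel bialgebra $(A,\ast,\Delta)$: a Zinbiel algebra and Zinbiel coalgebra such that for all $x,y,z$ $\Delta(y\ast z)+\tau\Delta(y\ast z)=(I\otimes L_\ast(y))\Delta(z)+\tau(L_\ast(y)\otimes I)\Delta(z)+\tau(I\otimes R_\ast(z))\Delta(y)=(I\otimes R_\ast(z))\Delta(y)+(L_\ast(y)\otimes I)\Delta(z)+\tau(I\otimes L_\ast(y))\Delta(z)$, $\Delta(x\star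 y)=(L_\ast(x)\otimes I)\Delta(y)+(I\otimes L_\star(y))\Delta(x)$. Pre-Lie bialgebra $(A,\circ,\delta)$: a pre-Lie algebra and pre-Lie coalgebra such that $\delta(x\circ y-y\circ x)=(L_\circ(x)\otimes I)\delta(y)+(I\otimes\mathrm{ad}(x))\delta(y)-(L_\circ(y)\otimes I)\delta(x)-(I\otimes\mathrm{ad}(y))\delta(x)$, $(I-\tau)\delta(x\circ y)=(I-\tau)\big((I\otimes R_\circ(y))\delta(x)+(L_\circ(x)\otimes I)\delta(y)+(I\otimes L_\circ(x))\delta(y)\big)$. Pre-Poisson bialgebra $(A,\ast,\circ,\Delta,\delta)$: $(A,\ast,\circ)$ pre-Poisson algebra, $(A,\Delta,\delta)$ pre-Poisson coalgebra, $(A,\ast,\Delta)$ Zinbiel bialgebra, $(A,\circ,\delta)$ pre-Lie bialgebra, and for all $x,y\in A$ $\delta(x\star y)=(I\otimes L_\star(x))\delta(y)+(I\otimes L_\star(y))\delta(x)-(L_\circ(x)\otimes I)\Delta(y)-(L_\circ(y)\otimes I)\Delta(x)$, $\Delta([x,y])=(L_\circ(x)\otimes I)\Delta(y)-(I\otimes L_\star(y))\delta(x)+(L_\ast(y)\otimes I)\delta(x)+(I\otimes\mathrm{ad}(x))\Delta(y)$, $\delta(x\ast y)-\tau\delta(x\ast y)=(I\otimes L_\ast(x))\delta(y)-\tau(L_\ast(x)\otimes I)\delta(y)-(L_\circ(x)\otimes I)\Delta(y)-\tau(I\otimes L_\circ(x))\Delta(y)+(I\otimes R_\ast(y))\delta(x)+\tau(I\otimes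 R_\circ(y))\Delta(x)$, $\Delta(x\circ y)+\tau\Delta(x\circ y)=(L_\circ(x)\otimes I)\Delta(y)+\tau(L_\circ(x)\otimes I)\Delta(y)+(I\otimes L_\circ(x))\Delta(y)+\tau(I\otimes L_\circ(x))\Delta(y)-(I\otimes R_\ast(y))\delta(x)-\tau(I\otimes R_\ast(y))\delta(x)$. It is called coboundary if there is some $r\in A\otimes A$ such that $\Delta$ and $\delta$ are given by the two formulas $\Delta(x)=(I\otimes L_\star(x)-L_\ast(x)\otimes I)r$ and $\delta(x)=(I\otimes\mathrm{ad}(x)+L_\circ(x)\otimes I)r$. *)

(* Defs.v *)
From HB Require Import structures.
From mathcomp Require Import all_boot all_order all_algebra.

Set Implicit Arguments.
Unset Strict Implicit.
Unset Printing Implicit Defensive.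

Import GRing.Theory.
Local Open Scope ring_scope.

Reserved Notation "u ⊗ v" (at level 40, left associativity).
Reserved Notation "f ⊠ g" (at level 40, left associativity).

(* The tensor product of finite-dimensional spaces, in coordinates. That it is
   the tensor product is the content of tprod_is_bilinear, tlift_tprod and
   tens_ext (universal property: existence and uniqueness). *)

Definition tens (k : fieldType) (U V : vectType k) : vectType k :=
  'M[k]_(\dim {:U}, \dim {:V}).

Definition tprod (k : fieldType) (U V : vectType k) (u : U) (v : V) :
  tens U V :=
  \matrix_(i, j) (coord (vbasis {:U}) i u * coord (vbasis {:V}) j v).

Notation "u ⊗ v" := (tprod u v) : ring_scope.

Definition tlift_fun (k : fieldType) (U V W : vectType k) (B : U -> V -> W)
    (t : tens U V) : W :=
  \sum_i \sum_j (t : 'M[k]_(_, _)) i j *: B (vbasis {:U})`_i (vbasis {:V})`_j.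

Fact tlift_fun_is_linear (k : fieldType) (U V W : vectType k)
  (B : U -> V -> W) : linear (tlift_fun B).
Proof.
move=> c s t; rewrite /tlift_fun scaler_sumr -big_split; apply: eq_bigr => i _.
rewrite scaler_sumr -big_split; apply: eq_bigr => j _.
by rewrite [X in X *: _]mxE [X in (X + _) *: _]mxE scalerDl scalerA.
Qed.

HB.instance Definition _ (k : fieldType) (U V W : vectType k)
    (B : U -> V -> W) :=
  GRing.isLinear.Build k (tens U V) W _ (tlift_fun B) (tlift_fun_is_linear B).

(* The linear map U ⊗ V -> W induced by B; meaningful when B is bilinear. *)
Definition tlift (k : fieldType) (U V W : vectType k) (B : U -> V -> W) :
  'Hom(tens U V, W) := linfun (tlift_fun B).

Lemma tprod_is_bilinear (k : fieldType) (U V : vectType k) :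
  bilinear_for *:%R *:%R (@tprod k U V).
Proof.
by split=> [v|u] c x y; apply/matrixP => i j; rewrite !mxE linearP /=;
  rewrite (mulrDl, mulrDr) (=^~ mulrA, mulrCA).
Qed.

HB.instance Definition _ (k : fieldType) (U V : vectType k) :=
  bilinear_isBilinear.Build k U V (tens U V) _ _ (@tprod k U V)
    (tprod_is_bilinear U V).

Lemma tlift_tprod (k : fieldType) (U V W : vectType k) (B : U -> V -> W) :
  bilinear_for *:%R *:%R B -> forall u v, tlift B (u ⊗ v) = B u v.
Proof.
move=> [Bl Br] u v; rewrite lfunE /= /tlift_fun.
pose BL v := HB.pack_for {linear U -> W} (B^~ v)
  (GRing.isLinear.Build k U W _ (B^~ v) (Bl v)).
pose BR u := HB.pack_for {linear V -> W} (B u)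
  (GRing.isLinear.Build k V W _ (B u) (Br u)).
rewrite {2}(coord_vbasis (memvf u)) -[RHS]/(BL v _) linear_sum; apply: eq_bigr => i _.
rewrite linearZ /= {2}(coord_vbasis (memvf v)) -[X in _ *: X]/(BR _ _).
rewrite linear_sum scaler_sumr; apply: eq_bigr => j _.
by rewrite linearZ /= scalerA mxE.
Qed.

Lemma tens_sum (k : fieldType) (U V : vectType k) (t : tens U V) :
  t = \sum_i \sum_j (t : 'M[k]_(_, _)) i j *: ((vbasis {:U})`_i ⊗ (vbasis {:V})`_j).
Proof.
rewrite [LHS]matrix_sum_delta; apply: eq_bigr => i _; apply: eq_bigr => j _.
congr (_ *: _); apply/matrixP => p q; rewrite !mxE.
have /andP[_ freeU] := vbasisP {:U}; have /andP[_ freeV] := vbasisP {:V}.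
rewrite !coord_free // (eq_sym p) (eq_sym q).
by do 2!case: eqP => _; rewrite ?(mulr0, mul0r, mulr1).
Qed.

Lemma tens_ext (k : fieldType) (U V W : vectType k) (f g : 'Hom(tens U V, W)) :
  (forall u v, f (u ⊗ v) = g (u ⊗ v)) -> f = g.
Proof.
move=> fg; apply/lfunP => t; rewrite (tens_sum t) !linear_sum.
apply: eq_bigr => i _; rewrite !linear_sum; apply: eq_bigr => j _.
by rewrite !linearZ /= fg.
Qed.

Definition tmap (k : fieldType) (U V U' V' : vectType k)
    (f : 'Hom(U, U')) (g : 'Hom(V, V')) : 'Hom(tens U V, tens U' V') :=
  tlift (fun u v => f u ⊗ g v).

(* f ⊠ g is the linear map f ⊗ g between tensor products. *)
Notation "f ⊠ g" := (tmap f g) : ring_scope.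

Definition tau (k : fieldType) (U V : vectType k) :
  'Hom(tens U V, tens V U) := tlift (fun u v => v ⊗ u).
Arguments tau {k U V}.

(* A ⊗ A ⊗ A is (A ⊗ A) ⊗ A; maps landing in A ⊗ (A ⊗ A) are followed by
   tassoc. *)
Definition tassoc (k : fieldType) (U V W : vectType k) :
    'Hom(tens U (tens V W), tens (tens U V) W) :=
  tlift (fun u => tlift (fun v w => u ⊗ v ⊗ w)).
Arguments tassoc {k U V W}.

Lemma tmapE (k : fieldType) (U V U' V' : vectType k)
  (f : 'Hom(U, U')) (g : 'Hom(V, V')) u v : (f ⊠ g) (u ⊗ v) = f u ⊗ g v.
Proof.
apply: (tlift_tprod (B := fun u v => f u ⊗ g v)).
by split=> [z|z] c x y; rewrite linearP (linearPl, linearPr).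
Qed.

Lemma tauE (k : fieldType) (U V : vectType k) (u : U) (v : V) :
  tau (u ⊗ v) = v ⊗ u.
Proof.
apply: (tlift_tprod (B := fun u v => v ⊗ u)).
by split=> [z|z] c x y; rewrite (linearPl, linearPr).
Qed.

Lemma tassocE (k : fieldType) (U V W : vectType k) (u : U) (v : V) (w : W) :
  tassoc (u ⊗ (v ⊗ w)) = u ⊗ v ⊗ w.
Proof.
have inner (x : U) (y : V) (z : W) :
    tlift (fun v w => x ⊗ v ⊗ w) (y ⊗ z) = x ⊗ y ⊗ z.
  apply: (tlift_tprod (B := fun v w => x ⊗ v ⊗ w)).
  split=> [t|t] c a b; last by rewrite linearPr.
  by rewrite (linearPr (@tprod k U V)) linearPl.
rewrite [tassoc _]tlift_tprod ?inner //.
split=> [z|z] c x y; last exact: linearP.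
pose T (u : U) : 'Hom(_, _) := tlift (fun (v : V) (w : W) => u ⊗ v ⊗ w).
have -> : tlift (fun v w => (c *: x + y) ⊗ v ⊗ w) = c *: T x + T y.
  apply: tens_ext => a b; rewrite add_lfunE scale_lfunE !inner.
  by rewrite (linearPl (@tprod k U V)) linearPl.
by rewrite [LHS]add_lfunE scale_lfunE.
Qed.

Section Operators.

Variables (k : fieldType) (A : vectType k).
Implicit Types (ast circ : {bilinear A -> A -> A}) (x y : A).

Definition Lop ast x : 'End(A) := linfun (ast x).
Definition Rop ast x : 'End(A) := linfun (applyr ast x).
Definition star ast x y : A := ast x y + ast y x.
Definition Lstar ast x : 'End(A) := Lop ast x + Rop ast x.
Definition bracket circ x y : A := circ x y - circ y x.
Definition ad circ x : 'End(A) := Lop circ x - Rop circ x.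

Lemma LopE ast x y : Lop ast x y = ast x y.
Proof. by rewrite lfunE. Qed.

Lemma RopE ast x y : Rop ast x y = ast y x.
Proof. by rewrite lfunE. Qed.

End Operators.

Section Algebras.

Variables (k : fieldType) (A : vectType k).
Implicit Types (ast circ : {bilinear A -> A -> A}).

Definition zinbiel_algebra ast : Prop :=
  forall x y z, ast x (ast y z) = ast (ast y x) z + ast (ast x y) z.

Definition pre_lie_algebra circ : Prop :=
  forall x y z, circ x (circ y z) - circ (circ x y) z
              = circ y (circ x z) - circ (circ y x) z.

Record pre_poisson_algebra ast circ : Prop := PrePoissonAlgebra {
  pre_poisson_zinbiel : zinbiel_algebra ast;
  pre_poisson_pre_lie : pre_lie_algebra circ;
  pre_poisson_bracketl : forall x y z,
    ast (bracket circ x y) z = circ x (ast y z) - ast y (circ x z);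
  pre_poisson_starl : forall x y z,
    circ (star ast x y) z = ast x (circ y z) + ast y (circ x z) }.

End Algebras.

Section YangBaxter.

Variables (k : fieldType) (A : vectType k).
Implicit Types (ast circ : {bilinear A -> A -> A}).

(* Evaluates \sum_(i, j) F a_i b_i a_j b_j for r = \sum_i a_i ⊗ b_i; by
   tlift2_sum it does not depend on the decomposition of r when F is linear in
   each argument. See ppybe_DE and ppybe_SE. *)
Definition tlift2 (W : vectType k) (F : A -> A -> A -> A -> W)
    (r : tens A A) : W :=
  tlift (fun ai bi => tlift (fun aj bj => F ai bi aj bj) r) r.

Definition ppybe_Dterm ast (ai bi aj bj : A) : tens (tens A A) A :=
  aj ⊗ ast ai bj ⊗ bi + aj ⊗ ai ⊗ ast bi bj - star ast ai aj ⊗ bi ⊗ bj.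

Definition ppybe_Sterm circ (ai bi aj bj : A) : tens (tens A A) A :=
  - (circ ai aj ⊗ bi ⊗ bj) + ai ⊗ circ bi aj ⊗ bj
  + ai ⊗ aj ⊗ bracket circ bi bj.

Definition ppybe_D ast (r : tens A A) := tlift2 (ppybe_Dterm ast) r.
Definition ppybe_S circ (r : tens A A) := tlift2 (ppybe_Sterm circ) r.

Definition ppybe ast circ (r : tens A A) : Prop :=
  ppybe_D ast r = 0 /\ ppybe_S circ r = 0.

Definition symmetric_tensor (r : tens A A) : Prop := tau r = r.

Lemma tlift2_sum (W : vectType k) (F : A -> A -> A -> A -> W)
    (I : finType) (a b : I -> A) :
  (forall u v, bilinear_for *:%R *:%R (F u v)) ->
  (forall u v, bilinear_for *:%R *:%R (fun x y => F x y u v)) ->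
  tlift2 F (\sum_i a i ⊗ b i) = \sum_i \sum_j F (a i) (b i) (a j) (b j).
Proof.
move=> F34 F12; rewrite /tlift2; set r := (X in tlift _ X).
have tliftr u v : tlift (F u v) r = \sum_j F u v (a j) (b j).
  by rewrite linear_sum; apply: eq_bigr => j _; rewrite /= tlift_tprod.
rewrite linear_sum; apply: eq_bigr => i _; rewrite /= tlift_tprod ?tliftr //.
split=> [v|u] c x y; rewrite /= 3!tliftr scaler_sumr -big_split;
  apply: eq_bigr => j _.
- exact: (F12 _ _).1.
- exact: (F12 _ _).2.
Qed.

Let add3 (V : zmodType) (a b c d e f : V) :
  (a + b) + (c + d) + (e + f) = (a + c + e) + (b + d + f).
Proof. by rewrite (addrACA a) [LHS]addrACA. Qed.

Let tprodPl (U V : vectType k) c (x y : U) (v : V) :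
  (c *: x + y) ⊗ v = c *: (x ⊗ v) + y ⊗ v.
Proof. by rewrite linearPl. Qed.

Let tprodPr (U V : vectType k) c (x y : V) (u : U) :
  u ⊗ (c *: x + y) = c *: (u ⊗ x) + u ⊗ y.
Proof. by rewrite linearPr. Qed.

Let opPl (m : {bilinear A -> A -> A}) c x y z :
  m (c *: x + y) z = c *: m x z + m y z.
Proof. by rewrite linearPl. Qed.

Let opPr (m : {bilinear A -> A -> A}) c x y z :
  m z (c *: x + y) = c *: m z x + m z y.
Proof. by rewrite linearPr. Qed.

Let starPl (m : {bilinear A -> A -> A}) c x y z :
  star m (c *: x + y) z = c *: star m x z + star m y z.
Proof. by rewrite /star opPl opPr scalerDr addrACA. Qed.

Let starPr (m : {bilinear A -> A -> A}) c x y z :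
  star m z (c *: x + y) = c *: star m z x + star m z y.
Proof. by rewrite /star opPl opPr scalerDr addrACA. Qed.

Let bracketPl (m : {bilinear A -> A -> A}) c x y z :
  bracket m (c *: x + y) z = c *: bracket m x z + bracket m y z.
Proof. by rewrite /bracket opPl opPr scalerBr opprD addrACA. Qed.

Let bracketPr (m : {bilinear A -> A -> A}) c x y z :
  bracket m z (c *: x + y) = c *: bracket m z x + bracket m z y.
Proof. by rewrite /bracket opPl opPr scalerBr opprD addrACA. Qed.

Let multiP := (starPl, starPr, bracketPl, bracketPr, opPl, opPr,
  tprodPl, tprodPr).

Lemma ppybe_DE ast (I : finType) (a b : I -> A) :
  ppybe_D ast (\sum_i a i ⊗ b i)
    = \sum_i \sum_j (a j ⊗ ast (a i) (b j) ⊗ b i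
                     + a j ⊗ a i ⊗ ast (b i) (b j)
                     - star ast (a i) (a j) ⊗ b i ⊗ b j).
Proof.
apply: tlift2_sum => u v; split=> [z|z] c x y; rewrite /ppybe_Dterm /= !multiP;
  by rewrite scalerBr scalerDr opprD add3.
Qed.

Lemma ppybe_SE circ (I : finType) (a b : I -> A) :
  ppybe_S circ (\sum_i a i ⊗ b i)
    = \sum_i \sum_j (- (circ (a i) (a j) ⊗ b i ⊗ b j)
                     + a i ⊗ circ (b i) (a j) ⊗ b j
                     + a i ⊗ a j ⊗ bracket circ (b i) (b j)).
Proof.
apply: tlift2_sum => u v; split=> [z|z] c x y; rewrite /ppybe_Sterm /= !multiP;
  by rewrite !scalerDr scalerN opprD add3.
Qed.

End YangBaxter.

Section Bialgebras.

Variables (k : fieldType) (A : vectType k).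
Implicit Types (ast circ : {bilinear A -> A -> A}).
Implicit Types (Delta delta : 'Hom(A, tens A A)).

Local Notation I := (\1%VF : 'End(A)).

Definition zinbiel_coalgebra Delta : Prop := forall x,
  (Delta ⊠ I) (Delta x) + (tau ⊠ I) ((Delta ⊠ I) (Delta x))
  = tassoc ((I ⊠ Delta) (Delta x)).

Definition pre_lie_coalgebra delta : Prop := forall x,
  (delta ⊠ I) (delta x) - tassoc ((I ⊠ delta) (delta x))
  = (tau ⊠ I) ((delta ⊠ I) (delta x) - tassoc ((I ⊠ delta) (delta x))).

Record pre_poisson_coalgebra Delta delta : Prop := PrePoissonCoalgebra {
  pre_poisson_co_zinbiel : zinbiel_coalgebra Delta;
  pre_poisson_co_pre_lie : pre_lie_coalgebra delta;
  pre_poisson_co_bracket : forall x,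
    ((delta - (tau \o delta)%VF) ⊠ I) (Delta x)
    = tassoc ((I ⊠ Delta) (delta x))
      - (tau ⊠ I) (tassoc ((I ⊠ delta) (Delta x)));
  pre_poisson_co_star : forall x,
    ((Delta + (tau \o Delta)%VF) ⊠ I) (delta x)
    = tassoc ((I ⊠ delta) (Delta x))
      + (tau ⊠ I) (tassoc ((I ⊠ delta) (Delta x))) }.

Record zinbiel_bialgebra ast Delta : Prop := ZinbielBialgebra {
  zinbiel_bi_alg : zinbiel_algebra ast;
  zinbiel_bi_coalg : zinbiel_coalgebra Delta;
  zinbiel_bi_ast1 : forall y z,
    Delta (ast y z) + tau (Delta (ast y z))
    = (I ⊠ Lop ast y) (Delta z) + tau ((Lop ast y ⊠ I) (Delta z))
      + tau ((I ⊠ Rop ast z) (Delta y));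
  zinbiel_bi_ast2 : forall y z,
    Delta (ast y z) + tau (Delta (ast y z))
    = (I ⊠ Rop ast z) (Delta y) + (Lop ast y ⊠ I) (Delta z)
      + tau ((I ⊠ Lop ast y) (Delta z));
  zinbiel_bi_star : forall x y,
    Delta (star ast x y)
    = (Lop ast x ⊠ I) (Delta y) + (I ⊠ Lstar ast y) (Delta x) }.

Record pre_lie_bialgebra circ delta : Prop := PreLieBialgebra {
  pre_lie_bi_alg : pre_lie_algebra circ;
  pre_lie_bi_coalg : pre_lie_coalgebra delta;
  pre_lie_bi_bracket : forall x y,
    delta (circ x y - circ y x)
    = (Lop circ x ⊠ I) (delta y) + (I ⊠ ad circ x) (delta y)
      - (Lop circ y ⊠ I) (delta x) - (I ⊠ ad circ y) (delta x);
  pre_lie_bi_circ : forall x y,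
    (\1%VF - tau) (delta (circ x y))
    = (\1%VF - tau) ((I ⊠ Rop circ y) (delta x)
                      + (Lop circ x ⊠ I) (delta y)
                      + (I ⊠ Lop circ x) (delta y)) }.

Record pre_poisson_bialgebra ast circ Delta delta : Prop :=
  PrePoissonBialgebra {
  pre_poisson_bi_alg : pre_poisson_algebra ast circ;
  pre_poisson_bi_coalg : pre_poisson_coalgebra Delta delta;
  pre_poisson_bi_zinbiel : zinbiel_bialgebra ast Delta;
  pre_poisson_bi_pre_lie : pre_lie_bialgebra circ delta;
  pre_poisson_bi_star : forall x y,
    delta (star ast x y)
    = (I ⊠ Lstar ast x) (delta y) + (I ⊠ Lstar ast y) (delta x)
      - (Lop circ x ⊠ I) (Delta y) - (Lop circ y ⊠ I) (Delta x);
  pre_poisson_bi_bracket : forall x y,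
    Delta (bracket circ x y)
    = (Lop circ x ⊠ I) (Delta y) - (I ⊠ Lstar ast y) (delta x)
      + (Lop ast y ⊠ I) (delta x) + (I ⊠ ad circ x) (Delta y);
  pre_poisson_bi_ast : forall x y,
    delta (ast x y) - tau (delta (ast x y))
    = (I ⊠ Lop ast x) (delta y) - tau ((Lop ast x ⊠ I) (delta y))
      - (Lop circ x ⊠ I) (Delta y) - tau ((I ⊠ Lop circ x) (Delta y))
      + (I ⊠ Rop ast y) (delta x) + tau ((I ⊠ Rop circ y) (Delta x));
  pre_poisson_bi_circ : forall x y,
    Delta (circ x y) + tau (Delta (circ x y))
    = (Lop circ x ⊠ I) (Delta y) + tau ((Lop circ x ⊠ I) (Delta y))
      + (I ⊠ Lop circ x) (Delta y) + tau ((I ⊠ Lop circ x) (Delta y))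
      - (I ⊠ Rop ast y) (delta x) - tau ((I ⊠ Rop ast y) (delta x)) }.

Definition coboundary_Delta_fun ast (r : tens A A) (x : A) : tens A A :=
  (I ⊠ Lstar ast x - Lop ast x ⊠ I) r.

Definition coboundary_delta_fun circ (r : tens A A) (x : A) : tens A A :=
  (I ⊠ ad circ x + Lop circ x ⊠ I) r.

Let LopP (m : {bilinear A -> A -> A}) c x y :
  Lop m (c *: x + y) = c *: Lop m x + Lop m y.
Proof. by apply/lfunP => z; rewrite add_lfunE scale_lfunE !lfunE /= linearPl. Qed.

Let RopP (m : {bilinear A -> A -> A}) c x y :
  Rop m (c *: x + y) = c *: Rop m x + Rop m y.
Proof. by apply/lfunP => z; rewrite add_lfunE scale_lfunE !lfunE /= linearPr. Qed.

Let tmapIP c (f g : 'End(A)) : I ⊠ (c *: f + g) = c *: (I ⊠ f) + I ⊠ g.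
Proof.
apply: tens_ext => u v.
by rewrite add_lfunE scale_lfunE !tmapE add_lfunE scale_lfunE linearPr.
Qed.

Let tmapPI c (f g : 'End(A)) : (c *: f + g) ⊠ I = c *: (f ⊠ I) + g ⊠ I.
Proof.
apply: tens_ext => u v.
by rewrite add_lfunE scale_lfunE !tmapE add_lfunE scale_lfunE linearPl.
Qed.

Fact coboundary_Delta_fun_is_linear ast r : linear (coboundary_Delta_fun ast r).
Proof.
move=> c x y; rewrite /coboundary_Delta_fun /Lstar LopP RopP.
rewrite (addrACA (c *: _)) -scalerDr tmapIP tmapPI opprD addrACA -scalerBr.
by rewrite [LHS]add_lfunE scale_lfunE.
Qed.

Fact coboundary_delta_fun_is_linear circ r : linear (coboundary_delta_fun circ r).
Proof.
move=> c x y; rewrite /coboundary_delta_fun /ad LopP RopP opprD.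
rewrite (addrACA (c *: _)) -scalerBr tmapIP tmapPI addrACA -scalerDr.
by rewrite [LHS]add_lfunE scale_lfunE.
Qed.

HB.instance Definition _ ast r :=
  GRing.isLinear.Build k A (tens A A) _ (coboundary_Delta_fun ast r)
    (coboundary_Delta_fun_is_linear ast r).

HB.instance Definition _ circ r :=
  GRing.isLinear.Build k A (tens A A) _ (coboundary_delta_fun circ r)
    (coboundary_delta_fun_is_linear circ r).

Definition coboundary_Delta ast r : 'Hom(A, tens A A) := linfun (coboundary_Delta_fun ast r).
Definition coboundary_delta circ r : 'Hom(A, tens A A) := linfun (coboundary_delta_fun circ r).

Lemma coboundary_DeltaE ast r x :
  coboundary_Delta ast r x = (I ⊠ Lstar ast x - Lop ast x ⊠ I) r.
Proof. by rewrite lfunE. Qed.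

Lemma coboundary_deltaE circ r x :
  coboundary_delta circ r x = (I ⊠ ad circ x + Lop circ x ⊠ I) r.
Proof. by rewrite lfunE. Qed.

Definition coboundary_pre_poisson_bialgebra ast circ Delta delta : Prop :=
  pre_poisson_bialgebra ast circ Delta delta /\
  exists r : tens A A, forall x,
    Delta x = (I ⊠ Lstar ast x - Lop ast x ⊠ I) r /\
    delta x = (I ⊠ ad circ x + Lop circ x ⊠ I) r.

End Bialgebras.

(* Main.v *)
Require Import Defs.
From mathcomp Require Import all_boot all_order all_algebra.
From mathcomp Require Import ring.

Set Implicit Arguments.
Unset Strict Implicit.
Unset Printing Implicit Defensive.

Import GRing.Theory.
Local Open Scope ring_scope.

(** A tensor is determined by its values on products of functionals, so every
    identity to be proved is an identity of scalars.  The tensor [r] gives the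
    map [sharp r : A* -> A] contracting the second factor, and a cobracket
    [D : A -> A ⊗ A] gives the product [(dual_mul D a b) x = (a ⊗ b) (D x)] on
    [A*].  Write [T] for [sharp r].

    Symmetry of [r] means [a (T b) = b (T a)].  Then the two coboundary maps
    define the products
      [a . b = b (_ ⋆ T a) - a (_ * T b)]   and
      [a o b = b [_, T a] + a (_ o T b)]
    on [A*], and the two halves of the pre-Poisson Yang-Baxter equation say
    exactly that [T] is a homomorphism for them:
      [T (a . b) = T a * T b]   and   [T (a o b) = T a o T b]
    ([sharp_dual_mul_Delta], [sharp_dual_mul_delta]).  The pre-Poisson coalgebra
    axioms for [(Delta, delta)] are the pre-Poisson algebra axioms for the dual
    products.  Evaluate one of them at [x]: as [T] is a homomorphism, both sides
    become sums of terms [a w], [b w], [c w] with [w] a product in [A] of [x]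
    and two of [T a], [T b], [T c], and the words attached to each functional
    agree by the axioms of [A] ([coboundary_pre_poisson_coalgebra]).

    The compatibility conditions are linear in [r] and come from its symmetry.
    Write [r] as the sum of [u_i ⊗ v_i].  In the terms that carry [tau]
    replace it by the sum of [v_i ⊗ u_i]; then both sides agree summand by
    summand, again by the axioms of [A]
    ([coboundary_pre_poisson_bialgebra_of_coalgebra]). *)

(** * Tensors and functionals *)

Section Pairing.

Variable k : fieldType.
Implicit Types U V W : vectType k.

Local Notation dual U := 'Hom(U, k^o).

(** The functional [a ⊗ b] on [U ⊗ V]. *)
Definition pairt U V (a : dual U) (b : dual V) : dual (tens U V) :=
  tlift (fun u v => a u * b v : k^o).

Definition contr U V (b : dual V) : 'Hom(tens U V, U) :=
  tlift (fun u v => b v *: u).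

Lemma pairtE U V (a : dual U) (b : dual V) u v :
  pairt a b (u ⊗ v) = a u * b v :> k.
Proof.
apply: (tlift_tprod (B := fun u v => a u * b v : k^o)).
by split=> [z|z] c x y; rewrite linearP /= (mulrDl, mulrDr) (=^~ mulrA, mulrCA).
Qed.

(** This equation and the next are taken in [k], not in its regular module
    [k^o], so that the right-hand sides are ring expressions over [k]. *)
Lemma dualD U (a : dual U) x y : a (x + y) = a x + a y :> k.
Proof. by rewrite linearD. Qed.

Lemma dualN U (a : dual U) x : a (- x) = - a x :> k.
Proof. by rewrite linearN. Qed.

Lemma contrE U V (b : dual V) (u : U) v : contr U b (u ⊗ v) = b v *: u.
Proof.
apply: (tlift_tprod (B := fun u v => b v *: u)).
split=> [z|z] c x y; first by rewrite /= scalerDr !scalerA (mulrC c).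
by rewrite linearP /= scalerDl scalerA.
Qed.

Lemma pairt_contr U V (a : dual U) (b : dual V) t :
  pairt a b t = a (contr U b t).
Proof.
suff -> : pairt a b = (a \o contr U b)%VF by rewrite comp_lfunE.
by apply: tens_ext => u v; rewrite comp_lfunE pairtE contrE linearZ /= mulrC.
Qed.

Lemma pairt_tmap U V U' V' (f : 'Hom(U, U')) (g : 'Hom(V, V')) a b t :
  pairt a b ((f ⊠ g) t) = pairt (a \o f)%VF (b \o g)%VF t.
Proof.
suff <- : (pairt a b \o (f ⊠ g))%VF = pairt (a \o f)%VF (b \o g)%VF
  by rewrite comp_lfunE.
by apply: tens_ext => u v; rewrite comp_lfunE tmapE !pairtE !comp_lfunE.
Qed.

Lemma pairt_tau U V (a : dual U) (b : dual V) t :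
  pairt a b (tau t) = pairt b a t.
Proof.
suff <- : (pairt a b \o tau)%VF = pairt b a by rewrite comp_lfunE.
by apply: tens_ext => u v; rewrite comp_lfunE tauE !pairtE mulrC.
Qed.

Lemma pairt_comp_tau U V (a : dual U) (b : dual V) :
  (pairt a b \o tau)%VF = pairt b a.
Proof. by apply/lfunP => t; rewrite comp_lfunE pairt_tau. Qed.

Lemma pairt_tassoc U V W (a : dual U) (b : dual V) (c : dual W) t :
  pairt (pairt a b) c (tassoc t) = pairt a (pairt b c) t.
Proof.
(* For fixed [u] both sides are linear in the tensor [s] of [t = u ⊗ s], which
   reduces the claim to [s = v ⊗ w]. *)
pose B : {bilinear U -> tens V W -> tens U (tens V W)} := @tprod k U (tens V W).
have e u : (pairt (pairt a b) c \o tassoc \o linfun (B u) = a u *: pairt b c)%VF.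
  apply: tens_ext => v w; rewrite !comp_lfunE [linfun (B u) _]lfunE /= tassocE.
  by rewrite scale_lfunE !pairtE -mulrA.
suff <- : (pairt (pairt a b) c \o tassoc)%VF = pairt a (pairt b c)
  by rewrite comp_lfunE.
apply: tens_ext => u s; have := congr1 (fun f : 'Hom(_, _) => f s) (e u).
by rewrite /= !comp_lfunE [linfun (B u) _]lfunE /= scale_lfunE pairtE.
Qed.

Lemma dual_inj U (x y : U) : (forall a : dual U, a x = a y) -> x = y.
Proof.
move=> e; rewrite (coord_vbasis (memvf x)) (coord_vbasis (memvf y)).
apply: eq_bigr => i _; congr (_ *: _).
by have := e (linfun (coord (vbasis {:U}) i : U -> k^o)); rewrite !lfunE.
Qed.

(** Contracting against the coordinate functionals of [V] gives the columns of
    the matrix of a tensor. *)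
Lemma contr_inj U V (s t : tens U V) :
  (forall b, contr U b s = contr U b t) -> s = t.
Proof.
pose c (j : 'I_(\dim {:V})) : dual V := linfun (coord (vbasis {:V}) j : V -> k^o).
have E (t' : tens U V) j :
    contr U (c j) t' = \sum_i (t' : 'M[k]_(_, _)) i j *: (vbasis {:U})`_i.
  rewrite {1}(tens_sum t') linear_sum; apply: eq_bigr => i _.
  rewrite linear_sum (bigD1 j) //= big1 ?addr0 => [|l lj].
    rewrite linearZ /= contrE lfunE /= coord_free ?eqxx ?scale1r //.
    by have /andP[] := vbasisP {:V}.
  rewrite linearZ /= contrE lfunE /= coord_free.
    by rewrite (negPf lj) scale0r scaler0.
  by have /andP[] := vbasisP {:V}.
move=> e; apply/matrixP => i j.
have freeU : free (vbasis {:U}) by have /andP[] := vbasisP {:U}.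
have := e (c j); rewrite !E => /(congr1 (coord (vbasis {:U}) i)).
by rewrite !coord_sum_free.
Qed.

Lemma pairt_inj U V (s t : tens U V) :
  (forall a b, pairt a b s = pairt a b t) -> s = t.
Proof.
by move=> e; apply: contr_inj => b; apply: dual_inj => a; rewrite -!pairt_contr.
Qed.

Lemma pairt3_inj U V W (s t : tens (tens U V) W) :
  (forall a b c, pairt (pairt a b) c s = pairt (pairt a b) c t) -> s = t.
Proof.
move=> e; apply: contr_inj => c; apply: pairt_inj => a b.
by rewrite -!pairt_contr.
Qed.

Lemma tens_decomp U V (t : tens U V) :
  exists (I : finType) (a : I -> U) (b : I -> V), t = \sum_i a i ⊗ b i.
Proof.
pose I := ('I_(\dim {:U}) * 'I_(\dim {:V}))%type.
exists I, (fun p : I => (t : 'M[k]_(_, _)) p.1 p.2 *: (vbasis {:U})`_p.1),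
  (fun p : I => (vbasis {:V})`_p.2).
rewrite {1}(tens_sum t) pair_bigA; apply: eq_bigr => p _.
by rewrite linearZl_LR.
Qed.

End Pairing.

(** * Words in a pre-Poisson algebra *)

Section Bilinear.

Variables (k : fieldType) (A : vectType k) (m : {bilinear A -> A -> A}).

Lemma opDl x y z : m (x + y) z = m x z + m y z. Proof. exact: linearDl. Qed.
Lemma opDr x y z : m z (x + y) = m z x + m z y. Proof. exact: linearDr. Qed.
Lemma opNl x z : m (- x) z = - m x z. Proof. exact: linearNl. Qed.
Lemma opNr x z : m z (- x) = - m z x. Proof. exact: linearNr. Qed.

Lemma op_sum (I J : finType) (c : I -> k) (d : J -> k) (u : I -> A) (w : J -> A)
  (f : 'Hom(A, k^o)) :
  f (m (\sum_i c i *: u i) (\sum_j d j *: w j))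
  = \sum_i \sum_j c i * d j * f (m (u i) (w j)).
Proof.
rewrite linear_sumlz linear_sum; apply: eq_bigr => i _.
rewrite linear_sumr linear_sum; apply: eq_bigr => j _.
by rewrite linearZl_LR /= linearZr_LR /= !linearZ /= scalerA.
Qed.

End Bilinear.

Section Words.

Variables (k : fieldType) (A : vectType k) (ast circ : {bilinear A -> A -> A}).
Implicit Types x y z : A.

Lemma LstarE x y : Lstar ast x y = star ast x y.
Proof. by rewrite add_lfunE LopE RopE. Qed.

Lemma adE x y : ad circ x y = bracket circ x y.
Proof. by rewrite add_lfunE opp_lfunE LopE RopE. Qed.

(** The axioms of a pre-Poisson algebra, solved for one word each.  Used as
    rewrite rules on words in three distinct letters, the first two in every
    order of the letters and the last two in one order per pair [x], [y], they
    eliminate a different word for each relation, so they bring two words that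
    are equal by the axioms to the same combination of words. *)
Lemma ast_ast_rule : pre_poisson_algebra ast circ -> forall x y z,
  ast x (ast y z) = ast (ast y x) z + ast (ast x y) z.
Proof. by move=> ppA; exact: pre_poisson_zinbiel ppA. Qed.

Lemma circ_ast_rule : pre_poisson_algebra ast circ -> forall x y z,
  circ x (ast y z) = ast (circ x y) z - ast (circ y x) z + ast y (circ x z).
Proof.
move=> ppA x y z; rewrite -opNl -opDl -[_ - _]/(bracket circ x y).
by rewrite (pre_poisson_bracketl ppA) subrK.
Qed.

Lemma circ_circ_rule : pre_poisson_algebra ast circ -> forall x y z,
  circ y (circ x z) = circ x (circ y z) - circ (circ x y) z + circ (circ y x) z.
Proof. by move=> ppA x y z; rewrite (pre_poisson_pre_lie ppA) subrK. Qed.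

Lemma ast_circ_rule : pre_poisson_algebra ast circ -> forall x y z,
  circ (ast y x) z = ast x (circ y z) + ast y (circ x z) - circ (ast x y) z.
Proof.
move=> ppA x y z.
by rewrite -(pre_poisson_starl ppA) /star opDl [RHS]addrC addKr.
Qed.

End Words.

Ltac expand_words := rewrite /star /bracket ?(opDl, opDr, opNl, opNr).

Ltac reduce_words ppA :=
  rewrite ?(ast_ast_rule ppA, circ_ast_rule ppA) ?(opDl, opDr, opNl, opNr).

Ltac order_letters ppA x y :=
  rewrite ?(ast_circ_rule ppA x y) ?(circ_circ_rule ppA x y)
          ?(opDl, opDr, opNl, opNr).

(** * The Yang-Baxter equation *)

Section Sharp.

Variables (k : fieldType) (A : vectType k) (ast circ : {bilinear A -> A -> A}).
Variable r : tens A A.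
Hypothesis symr : symmetric_tensor r.

Local Notation dual := 'Hom(A, k^o).
Local Notation I := (\1%VF : 'End(A)).
Local Notation Delta := (coboundary_Delta ast r).
Local Notation delta := (coboundary_delta circ r).
Implicit Types (a b c : dual) (x y z : A) (D : 'Hom(A, tens A A)).

Definition sharp a : A := contr A a r.
Local Notation T := sharp.

Lemma sharpC a b : a (T b) = b (T a).
Proof. by rewrite -!pairt_contr -[in RHS]symr pairt_tau. Qed.

Lemma sharpD a b : T (a + b) = T a + T b.
Proof. by apply: dual_inj => c; rewrite linearD /= !(sharpC c) add_lfunE. Qed.

Lemma sharpN a : T (- a) = - T a.
Proof. by apply: dual_inj => c; rewrite linearN /= !(sharpC c) opp_lfunE. Qed.

(** Symmetry lets either factor of [r] be contracted. *)
Lemma sharp_sum (J : finType) (u v : J -> A) : r = \sum_i u i ⊗ v i ->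
  (forall a, T a = \sum_i a (v i) *: u i) * (forall a, T a = \sum_i a (u i) *: v i).
Proof.
have E (u' v' : J -> A) : r = \sum_i u' i ⊗ v' i ->
    forall a, T a = \sum_i a (v' i) *: u' i.
  by move=> e a; rewrite /sharp e linear_sum; apply: eq_bigr => i _; rewrite /= contrE.
move=> e; split; apply: E => //.
by rewrite -symr e linear_sum; apply: eq_bigr => i _; rewrite /= tauE.
Qed.

(** The Yang-Baxter equation in terms of [T]: each factor of a product in the
    equation is contracted into a value of [T], on whichever side of [r] the
    remaining functional leaves free. *)
Lemma ppybe_D_pair a b c : ppybe_D ast r = 0 ->
  b (ast (T c) (T a)) + c (ast (T b) (T a)) - a (star ast (T b) (T c)) = 0 :> k.
Proof.
have [J [u [v e]]] := tens_decomp r; have [E1 E2] := sharp_sum e.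
move=> /(congr1 (pairt (pairt a b) c)); rewrite linear0 => <-.
rewrite e ppybe_DE /star dualD.
have -> : b (ast (T c) (T a)) = \sum_i \sum_j c (v i) * a (u j) * b (ast (u i) (v j)).
  by rewrite E1 E2 op_sum.
have -> : c (ast (T b) (T a)) = \sum_i \sum_j b (u i) * a (u j) * c (ast (v i) (v j)).
  by rewrite !E2 op_sum.
have -> : a (ast (T b) (T c)) = \sum_i \sum_j b (v i) * c (v j) * a (ast (u i) (u j)).
  by rewrite !E1 op_sum.
(* Here [j] indexes the left factor, so that [T b] is summed over [i] as
   in the previous term. *)
have -> : a (ast (T c) (T b)) = \sum_i \sum_j c (v j) * b (v i) * a (ast (u j) (u i)).
  by rewrite !E1 op_sum exchange_big.
rewrite [RHS]linear_sum -!(big_split, sumrB) /=; apply: eq_bigr => i _.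
rewrite [RHS]linear_sum -!(big_split, sumrB) /=; apply: eq_bigr => j _.
rewrite !(dualD, dualN, pairtE); ring.
Qed.

Lemma ppybe_S_pair a b c : ppybe_S circ r = 0 ->
  b (circ (T a) (T c)) + c (bracket circ (T a) (T b)) - a (circ (T b) (T c)) = 0 :> k.
Proof.
have [J [u [v e]]] := tens_decomp r; have [E1 E2] := sharp_sum e.
move=> /(congr1 (pairt (pairt a b) c)); rewrite linear0 => <-.
rewrite e ppybe_SE /bracket dualD dualN.
have -> : a (circ (T b) (T c)) = \sum_i \sum_j b (v i) * c (v j) * a (circ (u i) (u j)).
  by rewrite !E1 op_sum.
have -> : b (circ (T a) (T c)) = \sum_i \sum_j a (u i) * c (v j) * b (circ (v i) (u j)).
  by rewrite (E2 a) (E1 c) op_sum.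
have -> : c (circ (T a) (T b)) = \sum_i \sum_j a (u i) * b (u j) * c (circ (v i) (v j)).
  by rewrite !E2 op_sum.
(* Here [j] indexes the left factor, so that [T a] is summed over [i] as
   in the previous term. *)
have -> : c (circ (T b) (T a)) = \sum_i \sum_j b (u j) * a (u i) * c (circ (v j) (v i)).
  by rewrite !E2 op_sum exchange_big.
rewrite [RHS]linear_sum -!(big_split, sumrB) /=; apply: eq_bigr => i _.
rewrite [RHS]linear_sum -!(big_split, sumrB) /=; apply: eq_bigr => j _.
rewrite !(dualD, dualN, pairtE); ring.
Qed.

Lemma pairt_idl a b (g : 'End(A)) : pairt a b ((I ⊠ g) r) = b (g (T a)).
Proof. by rewrite pairt_tmap comp_lfun1r pairt_contr -/(T _) sharpC comp_lfunE. Qed.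

Lemma pairt_idr a b (f : 'End(A)) : pairt a b ((f ⊠ I) r) = a (f (T b)).
Proof. by rewrite pairt_tmap comp_lfun1r pairt_contr -/(T _) comp_lfunE. Qed.

(** The product on the dual space transposed to a cobracket. *)
Definition dual_mul D a b : dual := (pairt a b \o D)%VF.

Lemma dual_mulE D a b x : dual_mul D a b x = pairt a b (D x).
Proof. by rewrite comp_lfunE. Qed.

Lemma dual_mul_DeltaE a b x : dual_mul Delta a b x
  = b (star ast x (T a)) - a (ast x (T b)).
Proof.
rewrite dual_mulE coboundary_DeltaE add_lfunE opp_lfunE dualD dualN pairt_idl pairt_idr.
by rewrite LstarE LopE.
Qed.

Lemma dual_mul_deltaE a b x : dual_mul delta a b x
  = b (bracket circ x (T a)) + a (circ x (T b)).
Proof.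
rewrite dual_mulE coboundary_deltaE add_lfunE dualD pairt_idl pairt_idr.
by rewrite adE LopE.
Qed.

(** On [A*] with the products transposed to the coboundaries, [T] is a
    homomorphism: by symmetry this only needs testing against a functional [c],
    where it is the Yang-Baxter equation with the slots permuted. *)
Lemma sharp_dual_mul_Delta a b : ppybe_D ast r = 0 ->
  T (dual_mul Delta a b) = ast (T a) (T b).
Proof.
move=> hD; apply: dual_inj => c; rewrite sharpC dual_mul_DeltaE.
have := ppybe_D_pair b c a hD; rewrite /star !dualD => h.
by apply/eqP; rewrite -subr_eq0 -oppr_eq0 -[X in _ == X]h; apply/eqP; ring.
Qed.

Lemma sharp_dual_mul_delta a b : ppybe_S circ r = 0 ->
  T (dual_mul delta a b) = circ (T a) (T b).
Proof.
move=> hS; apply: dual_inj => c; rewrite sharpC dual_mul_deltaE.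
have := ppybe_S_pair c a b hS; rewrite /bracket !(dualD, dualN) => h.
by apply/eqP; rewrite -subr_eq0 -[X in _ == X]h; apply/eqP; ring.
Qed.

Lemma dual_mulDl D D' a b :
  dual_mul (D + D') a b = dual_mul D a b + dual_mul D' a b.
Proof. by apply/lfunP => x; rewrite add_lfunE !dual_mulE add_lfunE linearD. Qed.

Lemma dual_mulNl D a b : dual_mul (- D) a b = - dual_mul D a b.
Proof. by apply/lfunP => x; rewrite opp_lfunE !dual_mulE opp_lfunE linearN. Qed.

Lemma dual_mul_tau D a b : dual_mul (tau \o D)%VF a b = dual_mul D b a.
Proof. by apply/lfunP => x; rewrite !dual_mulE comp_lfunE pairt_tau. Qed.

End Sharp.

(** * The coalgebra axioms *)

Section Coalgebra.

Variables (k : fieldType) (A : vectType k) (ast circ : {bilinear A -> A -> A}).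
Variable r : tens A A.

Local Notation dual := 'Hom(A, k^o).
Local Notation I := (\1%VF : 'End(A)).
Local Notation T := (sharp r).
Local Notation Delta := (coboundary_Delta ast r).
Local Notation delta := (coboundary_delta circ r).
Implicit Types (a b c : dual) (x y z : A) (D : 'Hom(A, tens A A)).

(** The next three lemmas turn a coalgebra axiom into an axiom for the dual
    products. *)
Lemma pairt3_DI D D' a b c x :
  pairt (pairt a b) c ((D ⊠ I) (D' x)) = dual_mul D' (dual_mul D a b) c x.
Proof. by rewrite pairt_tmap comp_lfun1r dual_mulE. Qed.

Lemma pairt3_ID D D' a b c x :
  pairt (pairt a b) c (tassoc ((I ⊠ D) (D' x))) = dual_mul D' a (dual_mul D b c) x.
Proof. by rewrite pairt_tassoc pairt_tmap comp_lfun1r dual_mulE. Qed.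

Lemma pairt3_tau a b c (t : tens (tens A A) A) :
  pairt (pairt a b) c ((tau ⊠ I) t) = pairt (pairt b a) c t.
Proof. by rewrite pairt_tmap comp_lfun1r pairt_comp_tau. Qed.

Hypothesis ppA : pre_poisson_algebra ast circ.
Hypothesis symr : symmetric_tensor r.
Hypothesis ybD : ppybe_D ast r = 0.
Hypothesis ybS : ppybe_S circ r = 0.

(* Expanding the outer product creates the terms [T (dual_mul _ _ _)], so the
   homomorphism property comes last.  The second expansion is for the axioms with
   a sum of products as inner factor, whose value at an element must first be
   split into summands. *)
Ltac dual_expand :=
  rewrite ?(dualD, dualN) ?pairt3_tau ?(dualD, dualN) ?pairt3_DI ?pairt3_ID
    ?dual_mulDl ?dual_mulNl ?dual_mul_tau
    ?(dual_mul_DeltaE ast symr) ?(dual_mul_deltaE circ symr)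
    ?(sharpD symr) ?(sharpN symr) ?add_lfunE ?opp_lfunE
    ?(dual_mul_DeltaE ast symr) ?(dual_mul_deltaE circ symr)
    ?(sharp_dual_mul_Delta symr _ _ ybD) ?(sharp_dual_mul_delta symr _ _ ybS).

Ltac dual_axiom x :=
  let a := fresh "a" in let b := fresh "b" in let c := fresh "c" in
  apply: pairt3_inj; intros a b c; dual_expand; expand_words; reduce_words ppA;
  order_letters ppA x (T a); order_letters ppA x (T b);
  order_letters ppA x (T c); order_letters ppA (T a) (T b);
  order_letters ppA (T a) (T c); order_letters ppA (T b) (T c);
  rewrite !(dualD, dualN); ring.

Lemma coboundary_zinbiel_coalgebra : zinbiel_coalgebra Delta.
Proof. by move=> x; dual_axiom x. Qed.

Lemma coboundary_pre_lie_coalgebra : pre_lie_coalgebra delta.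
Proof. by move=> x; dual_axiom x. Qed.

Lemma coboundary_co_bracket x :
  ((delta - (tau \o delta)%VF) ⊠ I) (Delta x)
  = tassoc ((I ⊠ Delta) (delta x)) - (tau ⊠ I) (tassoc ((I ⊠ delta) (Delta x))).
Proof. by dual_axiom x. Qed.

Lemma coboundary_co_star x :
  ((Delta + (tau \o Delta)%VF) ⊠ I) (delta x)
  = tassoc ((I ⊠ delta) (Delta x)) + (tau ⊠ I) (tassoc ((I ⊠ delta) (Delta x))).
Proof. by dual_axiom x. Qed.

Lemma coboundary_pre_poisson_coalgebra : pre_poisson_coalgebra Delta delta.
Proof.
split; [exact: coboundary_zinbiel_coalgebra | exact: coboundary_pre_lie_coalgebra
  | exact: coboundary_co_bracket | exact: coboundary_co_star].
Qed.

End Coalgebra.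

(** * The compatibility conditions *)

Section Compatibility.

Variables (k : fieldType) (A : vectType k) (ast circ : {bilinear A -> A -> A}).
Variable r : tens A A.
Hypothesis symr : symmetric_tensor r.

Local Notation dual := 'Hom(A, k^o).
Local Notation Delta := (coboundary_Delta ast r).
Local Notation delta := (coboundary_delta circ r).
Implicit Types (a b : dual) (x y : A).

(** Each lemma comes in two forms, one for each of the decompositions
    [\sum_i u i ⊗ v i] and [\sum_i v i ⊗ u i] of the symmetric tensor [r]. *)
Section Expansion.

Variables (J : finType) (u v : J -> A).
Hypothesis e : r = \sum_i u i ⊗ v i.

Lemma pair_r a b : pairt a b r = \sum_i a (u i) * b (v i) :> k.
Proof. by rewrite e linear_sum; apply: eq_bigr => i _; rewrite /= pairtE. Qed.

Lemma pair_rC a b : pairt a b r = \sum_i a (v i) * b (u i) :> k.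
Proof. by rewrite -{1}symr pairt_tau pair_r; apply: eq_bigr => i _; rewrite mulrC. Qed.

Lemma pair_Delta a b x :
  pairt a b (Delta x)
  = \sum_i (a (u i) * b (star ast x (v i)) - a (ast x (u i)) * b (v i)) :> k.
Proof.
rewrite coboundary_DeltaE add_lfunE opp_lfunE dualD dualN !pairt_tmap !pair_r -sumrB.
by apply: eq_bigr => i _; rewrite !comp_lfunE !id_lfunE LopE LstarE.
Qed.

Lemma pair_DeltaC a b x :
  pairt a b (Delta x)
  = \sum_i (a (v i) * b (star ast x (u i)) - a (ast x (v i)) * b (u i)) :> k.
Proof.
rewrite coboundary_DeltaE add_lfunE opp_lfunE dualD dualN !pairt_tmap !pair_rC -sumrB.
by apply: eq_bigr => i _; rewrite !comp_lfunE !id_lfunE LopE LstarE.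
Qed.

Lemma pair_delta a b x :
  pairt a b (delta x)
  = \sum_i (a (u i) * b (bracket circ x (v i)) + a (circ x (u i)) * b (v i)) :> k.
Proof.
rewrite coboundary_deltaE add_lfunE dualD !pairt_tmap !pair_r -big_split.
by apply: eq_bigr => i _; rewrite !comp_lfunE !id_lfunE LopE adE.
Qed.

Lemma pair_deltaC a b x :
  pairt a b (delta x)
  = \sum_i (a (v i) * b (bracket circ x (u i)) + a (circ x (v i)) * b (u i)) :> k.
Proof.
rewrite coboundary_deltaE add_lfunE dualD !pairt_tmap !pair_rC -big_split.
by apply: eq_bigr => i _; rewrite !comp_lfunE !id_lfunE LopE adE.
Qed.

End Expansion.

Lemma tauD (s t : tens A A) : tau (s + t) = tau s + tau t.
Proof. by rewrite linearD. Qed.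

Lemma tauN (s : tens A A) : tau (- s) = - tau s.
Proof. by rewrite linearN. Qed.

Lemma sumD (J : finType) (F G : J -> k) :
  \sum_i F i + \sum_i G i = \sum_i (F i + G i).
Proof. by rewrite big_split. Qed.

Lemma sumB (J : finType) (F G : J -> k) :
  \sum_i F i - \sum_i G i = \sum_i (F i - G i).
Proof. by rewrite sumrB. Qed.

Hypothesis ppA : pre_poisson_algebra ast circ.

(* A functional headed by [a] is the first factor of a pairing in the terms
   without [tau], one headed by [b] in the terms with it; this decides which of
   the two decompositions of [r] is used. *)
Ltac compatibility x y :=
  let a := fresh "a" in let b := fresh "b" in let i := fresh "i" in
  let J := fresh "J" in let u := fresh "u" in let v := fresh "v" in
  let e := fresh "e" in
  destruct (tens_decomp r) as [J [u [v e]]]; apply: pairt_inj; intros a b;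
  rewrite ?(tauD, tauN) ?(dualD, dualN) ?pairt_tau ?pairt_tmap;
  rewrite ?(pair_Delta e a) ?(pair_Delta e (a \o _))
          ?(pair_DeltaC e b) ?(pair_DeltaC e (b \o _));
  rewrite ?(pair_delta e a) ?(pair_delta e (a \o _))
          ?(pair_deltaC e b) ?(pair_deltaC e (b \o _));
  rewrite ?(sumD, sumB); apply: eq_bigr; intros i _;
  rewrite !comp_lfunE !id_lfunE ?LopE ?RopE ?LstarE ?adE;
  expand_words; reduce_words ppA; order_letters ppA x y;
  order_letters ppA x (u i); order_letters ppA y (u i);
  order_letters ppA x (v i); order_letters ppA y (v i);
  rewrite !(dualD, dualN); ring.

Lemma coboundary_zinbiel_bialgebra :
  zinbiel_coalgebra Delta -> zinbiel_bialgebra ast Delta.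
Proof.
move=> coA; split=> [||x y|x y|x y].
- exact: pre_poisson_zinbiel ppA.
- exact: coA.
- by compatibility x y.
- by compatibility x y.
- by compatibility x y.
Qed.

Lemma coboundary_pre_lie_bialgebra :
  pre_lie_coalgebra delta -> pre_lie_bialgebra circ delta.
Proof.
move=> coA; split=> [||x y|x y].
- exact: pre_poisson_pre_lie ppA.
- exact: coA.
- by compatibility x y.
- by rewrite !add_lfunE !opp_lfunE !id_lfunE; compatibility x y.
Qed.

Lemma coboundary_pre_poisson_bialgebra_of_coalgebra :
  pre_poisson_coalgebra Delta delta ->
  pre_poisson_bialgebra ast circ Delta delta.
Proof.
move=> coA; split=> [||||x y|x y|x y|x y].
- exact: ppA.
- exact: coA.
- exact: coboundary_zinbiel_bialgebra (pre_poisson_co_zinbiel coA).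
- exact: coboundary_pre_lie_bialgebra (pre_poisson_co_pre_lie coA).
- by compatibility x y.
- by compatibility x y.
- by compatibility x y.
- by compatibility x y.
Qed.

End Compatibility.

Theorem corollary4p16 (k : fieldType) (A : vectType k)
    (ast circ : {bilinear A -> A -> A}) (r : tens A A) :
  pre_poisson_algebra ast circ ->
  symmetric_tensor r ->
  ppybe ast circ r ->
  coboundary_pre_poisson_bialgebra ast circ
    (coboundary_Delta ast r) (coboundary_delta circ r).
Proof.
move=> ppA symr [ybD ybS]; split; last first.
  by exists r => x; rewrite coboundary_DeltaE coboundary_deltaE.
apply: coboundary_pre_poisson_bialgebra_of_coalgebra => //.
exact: coboundary_pre_poisson_coalgebra.
Qed.
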